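(* Let $G$ be a locally compact (Hausdorff) group, let $N$ be a closed normal subgroup of $G$, and let $H$ be an open subgroup of $G$. If $\mathfrak{B}(G)$ is left introverted, then $\mathfrak{B}(G/N)$ and $\mathfrak{B}(H)$ are left introverted, where $G/N$ carries the quotient topology and $H$ the subspace topology.
   Context: All topological spaces and groups are Hausdorff. For a topological group $G$, $\mathfrak{B}(G)$ denotes the Boolean algebra (under union, intersection, complement) of all clopen subsets of $G$. A $\mathfrak{B}(G)$-ultrafilter is an ultrafilter in this Boolean algebra. For a $\mathfrak{B}(G)$-ultrafilter $\mathcal{V}$ and $B\in\mathfrak{B}(G)$, put $\mathcal{V}\cdot B=\{s\in G: s^{-1}B\in\mathcal{V}\}$. The Boolean algebra $\mathfrak{B}(G)$ is called left introverted if $\mathcal{V}\cdot B\in\mathfrak{B}(G)$ (i.e. $\mathcal{V}\cdot B$ is clopen in $G$) for every $\mathfrak{B}(G)$-ultrafilter $\mathcal{V}$ and every $B\in\mathfrak{B}(G)$. The same definitions apply to the topological groups $G/N$ and $H$. *)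

(* Defs.v *)
From HB Require Import structures.
From mathcomp Require Import all_boot generic_quotient.
From mathcomp Require Import boolp classical_sets functions filter topology.

Set Implicit Arguments.
Unset Strict Implicit.
Unset Printing Implicit Defensive.

Local Open Scope classical_set_scope.
Local Open Scope quotient_scope.
Local Open Scope group_scope.

HB.mixin Record isTopologicalGroup G & Topological G & Group G := {
  mulg_continuous : continuous (fun x : G * G => x.1 * x.2);
  invg_continuous : continuous (fun x : G => x^-1)
}.

#[short(type="topologicalGroupType")]
HB.structure Definition TopologicalGroup :=
  {G of Topological G & Group G & isTopologicalGroup G}.

HB.mixin Record isConjgClosed (G : groupType) (S : {pred G}) := {
  gpredJl : forall x y : G, x \in S -> x ^ y \in S
}.

#[short(type="normalGroupClosed")]
HB.structure Definition NormalGroupClosed (G : groupType) :=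
  {S of GroupClosed G S & isConjgClosed G S}.

(* The subgroup H as a topological group; as a space it is [set_type [set` H]],
   which carries the subspace topology. *)
Definition subgroup (G : topologicalGroupType) (H : groupClosed G) : Type :=
  set_type [set` H].

Section Subgroup.
Variables (G : topologicalGroupType) (H : groupClosed G).
Local Notation sH := (subgroup H).

HB.instance Definition _ := SubChoice.copy sH (set_type [set` H]).
HB.instance Definition _ := Topological.copy sH (set_type [set` H]).

Lemma subgroup_closed : group_closed [in [set` H]].
Proof.
split=> [|x y]; rewrite !inE/=; first exact: gpred1.
by move=> Hx Hy; exact: gpredF.
Qed.

HB.instance Definition _ := SubChoice_isSubGroup.Build G _ sH subgroup_closed.

Lemma subgroup_val_continuous : continuous (val : sH -> G).
Proof. exact: initial_continuous. Qed.

Lemma subgroup_continuous (T : topologicalType) (f : T -> sH) :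
  continuous (fun t => val (f t)) -> continuous f.
Proof.
move=> /continuousP cf; apply/continuousP => _ [A oA <-].
exact: cf.
Qed.

Lemma subgroup_mul_continuous : continuous (fun x : sH * sH => x.1 * x.2).
Proof.
apply: subgroup_continuous => x.
rewrite (_ : (fun t => _) = (fun p : G * G => p.1 * p.2) \o
  (fun t : sH * sH => (val t.1, val t.2))); last first.
  by apply/funext => t /=; exact: (valM (H := sH)).
apply: continuous_comp; last exact: mulg_continuous.
apply: cvg_pair; apply: continuous_comp.
- exact: cvg_fst.
- exact: subgroup_val_continuous.
- exact: cvg_snd.
- exact: subgroup_val_continuous.
Qed.

Lemma subgroup_inv_continuous : continuous (fun x : sH => x^-1).
Proof.
apply: subgroup_continuous => x.
rewrite (_ : (fun t => _) = (fun p : G => p^-1) \o (val : sH -> G)); last first.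
  by apply/funext => t /=; exact: (gmulfV (val : sH -> G)).
apply: continuous_comp; last exact: invg_continuous.
exact: subgroup_val_continuous.
Qed.

HB.instance Definition _ := isTopologicalGroup.Build sH
  subgroup_mul_continuous subgroup_inv_continuous.

End Subgroup.

Section QuotientGroup.
Variables (G : topologicalGroupType) (N : normalGroupClosed G).

Definition coset_rel (x y : G) := x^-1 * y \in N.

Lemma coset_rel_equiv : equiv_class_of coset_rel.
Proof.
rewrite /coset_rel; split=> [x|x y|y x z].
- by rewrite mulVg gpred1.
- by rewrite -(gpredV N) invgM invgK.
- move=> Nxy Nyz; have -> : x^-1 * z = (x^-1 * y) * (y^-1 * z).
    by rewrite mulgA mulgK.
  exact: gpredM.
Qed.

Canonical coset_equiv := EquivRelPack coset_rel_equiv.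
Canonical coset_encModRel := defaultEncModRel coset_rel.

End QuotientGroup.

(* The group G/N of cosets xN, with the quotient topology. *)
Definition quotient_group (G : topologicalGroupType) (N : normalGroupClosed G)
  : Type := quotient_topology {eq_quot (coset_rel N)}.

Section QuotientGroupTheory.
Variables (G : topologicalGroupType) (N : normalGroupClosed G).
Local Notation Q := (quotient_group N).

HB.instance Definition _ := Topological.copy Q
  (quotient_topology {eq_quot (coset_rel N)}).
HB.instance Definition _ := Quotient.copy Q
  (quotient_topology {eq_quot (coset_rel N)}).

Definition coset_pi (x : G) : Q := \pi_Q x.

Lemma coset_piP (x y : G) : coset_pi x = coset_pi y <-> x^-1 * y \in N.
Proof.
by split=> [/eqquotP//|Nxy]; apply/(@eqquotP _ (coset_rel N)).
Qed.

Definition coset_one : Q := coset_pi 1.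
Definition coset_inv (a : Q) : Q := coset_pi (repr a)^-1.
Definition coset_mul (a b : Q) : Q := coset_pi (repr a * repr b).

Lemma coset_piK (a : Q) : coset_pi (repr a) = a. Proof. exact: reprK. Qed.

Lemma coset_piM (x y : G) : coset_mul (coset_pi x) (coset_pi y) = coset_pi (x * y).
Proof.
apply/coset_piP; set x' := repr _; set y' := repr _.
have /coset_piP Nx : coset_pi x' = coset_pi x by exact: coset_piK.
have /coset_piP Ny : coset_pi y' = coset_pi y by exact: coset_piK.
have -> : (x' * y')^-1 * (x * y) = (x'^-1 * x) ^ y' * (y'^-1 * y).
  by rewrite conjgE invgM !mulgA mulgK.
by rewrite gpredM// gpredJl.
Qed.

Lemma coset_piV (x : G) : coset_inv (coset_pi x) = coset_pi x^-1.
Proof.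
apply/coset_piP; set x' := repr _.
have /coset_piP Nx : coset_pi x' = coset_pi x by exact: coset_piK.
have -> : x'^-1^-1 * x^-1 = ((x'^-1 * x) ^ x'^-1)^-1.
  by rewrite conjgE !(invgM, invgK) !mulgA mulgK.
by rewrite gpredV gpredJl.
Qed.

Lemma coset_mulA : associative coset_mul.
Proof.
move=> a b c; rewrite -(coset_piK a) -(coset_piK b) -(coset_piK c).
by rewrite !coset_piM mulgA.
Qed.

Lemma coset_mul1 : left_id coset_one coset_mul.
Proof. by move=> a; rewrite -(coset_piK a) coset_piM mul1g. Qed.

Lemma coset_mulr1 : right_id coset_one coset_mul.
Proof. by move=> a; rewrite -(coset_piK a) coset_piM mulg1. Qed.

Lemma coset_mulV : left_inverse coset_one coset_inv coset_mul.
Proof. by move=> a; rewrite -(coset_piK a) coset_piV coset_piM mulVg. Qed.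

Lemma coset_mulrV : right_inverse coset_one coset_inv coset_mul.
Proof. by move=> a; rewrite -(coset_piK a) coset_piV coset_piM mulgV. Qed.

HB.instance Definition _ := isGroup.Build Q
  coset_mulA coset_mul1 coset_mulr1 coset_mulV coset_mulrV.

Lemma coset_pi_continuous : continuous coset_pi.
Proof. exact: pi_continuous. Qed.

Lemma mulgr_continuous (y : G) : continuous (fun x : G => x * y).
Proof.
move=> x; apply: (@continuous_comp _ _ _ (fun x => (x, y))
  (fun p : G * G => p.1 * p.2)); last exact: mulg_continuous.
by apply: cvg_pair; [exact: cvg_id|exact: cvg_cst].
Qed.

Lemma coset_pi_open (A : set G) : open A -> open (coset_pi @` A).
Proof.
move=> oA; rewrite /open/= /quotient_open/=.
rewrite (_ : _ @^-1` _ = \bigcup_(n in [set` N]) (fun x => x * n) @^-1` A).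
  by apply: bigcup_open => n _; move/continuousP: (@mulgr_continuous n); apply.
apply/seteqP; split=> x /=.
  move=> [a Aa /esym/coset_piP Nxa]; exists (x^-1 * a) => //=.
  by rewrite mulgA mulgV mul1g.
move=> [n /= Nn Axn]; exists (x * n) => //.
by apply/coset_piP; rewrite invgM -mulgA mulVg mulg1 gpredV.
Qed.

Lemma coset_pi_nbhs (x : G) (A : set G) :
  nbhs x A -> nbhs (coset_pi x) (coset_pi @` A).
Proof.
rewrite !nbhsE => -[B [oB Bx] BA]; exists (coset_pi @` B).
  by split; [exact: coset_pi_open|exists x].
exact: image_subset.
Qed.

Lemma coset_mul_continuous : continuous (fun x : Q * Q => x.1 * x.2).
Proof.
move=> [a b] /=; rewrite -(coset_piK a) -(coset_piK b).
set x := repr a; set y := repr b => A.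
rewrite [_ * _]coset_piM => /coset_pi_continuous.
move=> /(@mulg_continuous G (x, y)) [[V W] [/= Vx Wy] VW].
exists (coset_pi @` V, coset_pi @` W).
  by split; exact: coset_pi_nbhs.
move=> [_ _] [/= [v Vv <-] [w Ww <-]].
by rewrite [_ * _]coset_piM; apply: (VW (v, w)).
Qed.

Lemma coset_inv_continuous : continuous (fun x : Q => x^-1).
Proof.
move=> a; rewrite -(coset_piK a); set x := repr a => A.
rewrite [_^-1]coset_piV => /coset_pi_continuous /(@invg_continuous G x) xA.
apply: filterS (coset_pi_nbhs xA) => _ [y yA <-] /=.
by rewrite [_^-1]coset_piV.
Qed.

HB.instance Definition _ := isTopologicalGroup.Build Q
  coset_mul_continuous coset_inv_continuous.

End QuotientGroupTheory.

Section ClopenUltrafilter.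
Variable T : topologicalType.

Record clopen_filter (V : set_system T) : Prop := {
  clopen_filter_clopen : V `<=` clopen;
  clopen_filterT : V setT;
  clopen_filter_not_empty : ~ V set0;
  clopen_filterI : forall A B, V A -> V B -> V (A `&` B);
  clopen_filterS : forall A B, clopen B -> A `<=` B -> V A -> V B
}.

Record clopen_ultrafilter (V : set_system T) : Prop := {
  clopen_ultra_filter : clopen_filter V;
  clopen_ultra_max : forall W, clopen_filter W -> V `<=` W -> W = V
}.

End ClopenUltrafilter.

(* V . B = {s | s^-1 B \in V} *)
Definition introversion (G : topologicalGroupType) (V : set_system G)
    (B : set G) : set G :=
  [set s | V ((fun x => s^-1 * x) @` B)].

Definition left_introverted (G : topologicalGroupType) : Prop :=
  forall (V : set_system G) (B : set G),
    clopen_ultrafilter V -> clopen B -> clopen (introversion V B).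

(* Main.v *)
Require Import Defs.
From mathcomp Require Import all_boot.
From mathcomp Require Import boolp classical_sets functions filter topology.

(** Every [B(G)]-ultrafilter is the trace on the clopen sets of an ultrafilter
    [U] on the set [G], so left introversion says that [{s | U (s^-1 B)}] is
    clopen for all [U] and all clopen [B].  In this form ultrafilters can be
    pushed forward along arbitrary maps: along the inclusion [H -> G], and along
    any section [G/N -> G], which need not be continuous nor a morphism. *)

Local Open Scope classical_set_scope.

Lemma ultra_fmap (T U : Type) (f : T -> U) (F : set_system T) :
  UltraFilter F -> UltraFilter (f @ F).
Proof.
move=> FU; split=> [|K KP sFK]; first exact: fmap_proper_filter.
apply/seteqP; split=> // A KA.
have [//|FnA] := in_ultra_setVsetC (f @^-1` A) FU.
have KnA : K (~` A) by exact: sFK.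
by exfalso; apply: (@filter_not_empty _ K); rewrite -(setICr A); exact: filterI.
Qed.

(** Maximality holds because complements of clopen sets are clopen: if [A] is clopen and not in [U],
    its complement is in the trace, so no clopen filter above the trace contains [A]. *)
Lemma clopen_ultrafilter_trace (T : topologicalType) (U : set_system T) :
  UltraFilter U -> clopen_ultrafilter (clopen `&` U).
Proof.
move=> UU; split.
  split=> [A []//||[_]|A B [cA UA] [cB UB]|A B cB AB [_ UA]].
  - by split; [exact: clopenT|exact: filterT].
  - exact: filter_not_empty.
  - by split; [exact: clopenI|exact: filterI].
  - by split=> //; exact: filterS UA.
move=> W WF sUW; apply/seteqP; split=> // A WA.
have cA := clopen_filter_clopen WF WA; split=> //.
have [//|UnA] := in_ultra_setVsetC A UU.
have WnA : W (~` A) by apply: sUW; split=> //; exact: clopenC.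
exfalso; apply: (clopen_filter_not_empty WF); rewrite -(setICr A).
exact: clopen_filterI.
Qed.

Lemma clopen_ultrafilter_extend (T : topologicalType) (V : set_system T) :
  clopen_ultrafilter V ->
  exists2 U : set_system T, UltraFilter U & V = clopen `&` U.
Proof.
move=> [VF Vmax].
(* The upward closure of [V] among all subsets. An ultrafilter above it has a trace containing [V],
   hence equal to [V] by maximality. *)
pose F : set_system T := [set A | exists2 C, V C & C `<=` A].
have FP : ProperFilter F.
  split.
    move=> [C VC]; rewrite subset0 => C0.
    by apply: (clopen_filter_not_empty VF); rewrite -C0.
  split.
  - by exists setT; [exact: clopen_filterT VF|].
  - move=> A B [C VC CA] [D VD DB].
    by exists (C `&` D); [exact: clopen_filterI|exact: setISS].
  - by move=> A B AB [C VC CA]; exists C => //; exact: subset_trans AB.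
have [U [UU sFU]] := ultraFilterLemma FP; exists U => //.
apply/esym/Vmax; first by have [] := clopen_ultrafilter_trace _ _ UU.
move=> A VA; split; first exact: clopen_filter_clopen VA.
by apply: sFU; exists A.
Qed.

Section LeftTranslation.
Local Open Scope group_scope.

Lemma image_mulVg (G : topologicalGroupType) (s : G) (B : set G) :
  (fun x => s^-1 * x) @` B = [set x | B (s * x)].
Proof.
apply/seteqP; split=> [_ [b Bb <-] /=|x /= Bx]; first by rewrite mulVKg.
by exists (s * x) => //; rewrite mulKg.
Qed.

Lemma mulgl_continuous (G : topologicalGroupType) (s : G) :
  continuous (fun x : G => s * x).
Proof.
move=> x; apply: (@continuous_comp _ _ _ (fun x => (s, x))
  (fun p : G * G => p.1 * p.2)); last exact: mulg_continuous.
by apply: cvg_pair; [exact: cvg_cst|exact: cvg_id].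
Qed.

(** The translate of [B] by [s^-1] is the preimage of [B] under the continuous map [x => s * x],
    hence clopen, so it lies in the trace of [U] exactly when it lies in [U]. *)
Lemma left_introvertedP (G : topologicalGroupType) :
  left_introverted G <->
  (forall (U : set_system G) (B : set G), UltraFilter U -> clopen B ->
     clopen [set s | U [set x | B (s * x)]]).
Proof.
have trE (U : set_system G) (B : set G) : clopen B ->
    introversion (clopen `&` U) B = [set s | U [set x | B (s * x)]].
  move=> cB; apply/seteqP.
  split=> s; rewrite /introversion /= image_mulVg; first by case.
  by split=> //; apply: (preimage_clopen (f := fun x => s * x)) => //; exact: mulgl_continuous.
split=> [Gli U B UU cB|Gli V B /clopen_ultrafilter_extend[U UU ->] cB].
  by rewrite -(trE U B cB); apply: Gli => //; exact: clopen_ultrafilter_trace.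
by rewrite trE//; exact: Gli.
Qed.

Lemma left_introverted_quotient (G : topologicalGroupType)
    (N : normalGroupClosed G) :
  left_introverted G -> left_introverted (quotient_group N).
Proof.
move=> /left_introvertedP Gli; apply/left_introvertedP => U B UU cB.
set W := (X in clopen X).
(* [repr] serves as the section; only [coset_pi (s * repr q) = coset_pi s * q] is used. *)
have piW : coset_pi N @^-1` W =
    [set s | (repr @ U) [set x | (coset_pi N @^-1` B) (s * x)]].
  apply/seteqP; split=> s; rewrite /W /= /nbhs/=; apply: filterS => q /=;
    by rewrite -coset_piM coset_piK.
have [oW cW] : clopen (coset_pi N @^-1` W).
  rewrite piW; apply: Gli; first exact: ultra_fmap.
  by apply: preimage_clopen => //; exact: coset_pi_continuous.
(* Openness in the quotient topology means openness of the preimage, and taking preimages commutes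
   with complements. *)
by split=> //; rewrite -openC; move: cW; rewrite -openC.
Qed.

Lemma open_subgroup_clopen (G : topologicalGroupType) (H : groupClosed G) :
  open [set` H] -> clopen [set` H].
Proof.
move=> oH; split=> //; rewrite -openC.
(* The complement of [H] is the union of the left cosets [xH] with [x] outside [H], each open as a
   preimage of [H] under a translation. *)
rewrite (_ : ~` _ = \bigcup_(x in ~` [set` H]) (fun y => x^-1 * y) @^-1` [set` H]).
  apply: bigcup_open => x _.
  by apply: open_comp => // y _; exact: mulgl_continuous.
apply/seteqP; split=> [x nHx|y [x /= nHx Hxy] Hy].
  by exists x => //=; rewrite mulVg gpred1.
by apply: nHx; rewrite /= -(gpredV H) -[x^-1](mulgK y) gpredM// gpredV.
Qed.

Lemma image_val_clopen (G : topologicalGroupType) (H : groupClosed G)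
    (B : set (subgroup H)) :
  open [set` H] -> clopen B -> clopen (val @` B).
Proof.
move=> /open_subgroup_clopen[oH cH].
have image_valE (A : set G) :
    val @` (val @^-1` A : set (subgroup H)) = A `&` [set` H].
  apply/seteqP; split=> [_ [x Ax <-]|x [Ax Hx]]; last first.
    by exists (Sub x (mem_set Hx)); rewrite /= ?SubK.
  by split=> //; have := valP x; rewrite inE.
move=> [[A oA <-]]; rewrite image_valE => clA.
split; first exact: openI.
(* The complement of [B] is the trace on [H] of an open [C], so the image of [B] is the closed set
   [H] minus [C]. *)
move: clA; rewrite -openC => -[C oC CA].
rewrite -image_valE -[_ @^-1` A]setCK -CA preimage_setC image_valE.
by apply: closedI => //; rewrite closedC.
Qed.

Lemma left_introverted_subgroup (G : topologicalGroupType) (H : groupClosed G) :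
  open [set` H] -> left_introverted G -> left_introverted (subgroup H).
Proof.
move=> oH /left_introvertedP Gli; apply/left_introvertedP => U B UU cB.
(* For [s] and [q] in [H], the product computed in [G] lies in the image of [B] exactly when [s * q]
   lies in [B], as [val] is an injective morphism. *)
rewrite (_ : [set s | _] = (val : subgroup H -> G) @^-1`
    [set s : G | (val @ U) [set x | (val @` B) (s * x)]]); last first.
  apply/seteqP; split=> s /=; rewrite /nbhs/=; apply: filterS => q /=.
    by move=> Bsq; exists (s * q).
  by move=> [b Bb]; rewrite -[RHS](valM s q) => /val_inj <-.
apply: preimage_clopen; last exact: subgroup_val_continuous.
apply: Gli; first exact: ultra_fmap.
exact: image_val_clopen.
Qed.

End LeftTranslation.

Theorem proposition2p6 (G : topologicalGroupType)
    (N : normalGroupClosed G) (H : groupClosed G) :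
  hausdorff_space G -> locally_compact [set: G] ->
  closed [set` N] -> open [set` H] ->
  left_introverted G ->
  left_introverted (quotient_group N) /\ left_introverted (subgroup H).
Proof.
move=> _ _ _ oH Gli; split; first exact: left_introverted_quotient.
exact: left_introverted_subgroup.
Qed.
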